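(* Let $(\mathbb{R}^{\mathbb{N}},\varepsilon_{\mathbb{N}})$ be the differential space whose differential structure $\varepsilon_{\mathbb{N}}$ is generated by the coordinate projections $\pi_i:\mathbb{R}^{\mathbb{N}}\to\mathbb{R}$, $i\in\mathbb{N}$. Then for every nonempty subset $M\subseteq\mathbb{R}^{\mathbb{N}}$, the differential subspace $(M,(\varepsilon_{\mathbb{N}})_M)$ is smoothly real-compact.
   Context: Let $M$ be a nonempty set and $\mathcal{C}$ a set of real functions on $M$. $\tau_{\mathcal{C}}$ is the weakest topology on $M$ making all functions in $\mathcal{C}$ continuous. $sc\,\mathcal{C}$ is the set of all functions $\omega\circ(f_1,\dots,f_n)$ with $n\in\mathbb{N}$, $f_1,\dots,f_n\in\mathcal{C}$, $\omega\in C^\infty(\mathbb{R}^n)$. For $A\subseteq M$, $\mathcal{C}_A$ is the set of all $f:A\to\mathbb{R}$ such that for every $p\in A$ there are an open neighbourhood $U\in\tau_{\mathcal{C}}$ of $p$ and $g\in\mathcal{C}$ with $f|_{U\cap A}=g|_{U\cap A}$. $\mathcal{C}$ is a differential structure on $M$ if $\mathcal{C}=sc\,\mathcal{C}$ and $\mathcal{C}=\mathcal{C}_M$; then $(M,\mathcal{C})$ is a differential space, and $\mathcal{C}$ is a unital real algebra. A differential subspace of $(M,\mathcal{C})$ is a pair $(A,\mathcal{C}_A)$ with $\emptyset\ne A\subseteq M$. The structure $\mathcal{C}$ is generated by a set $\mathcal{C}_0$ of real functions on $M$, written $\mathcal{C}=\operatorname{Gen}\mathcal{C}_0$, if $\mathcal{C}=(sc\,\mathcal{C}_0)_M$.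 The spectrum $\operatorname{Spec}\mathcal{C}$ is the set of unit-preserving algebra homomorphisms $\chi:\mathcal{C}\to\mathbb{R}$. For $p\in M$, $ev_p\in\operatorname{Spec}\mathcal{C}$ is $ev_p(f)=f(p)$. $(M,\mathcal{C})$ is smoothly real-compact if every $\chi\in\operatorname{Spec}\mathcal{C}$ equals $ev_p$ for some $p\in M$. *)

(* Defs.v *)
(* The real numbers are an arbitrary R : realType. *)
From HB Require Import structures.
From mathcomp Require Import all_boot all_order all_algebra.
From mathcomp Require Import all_classical all_reals all_analysis.

Set Implicit Arguments.
Unset Strict Implicit.
Unset Printing Implicit Defensive.

Import Order.TTheory GRing.Theory Num.Theory.
Import numFieldNormedType.Exports.

Local Open Scope classical_set_scope.
Local Open Scope ring_scope.

(* omega \in C^k(R^n): all iterated partial derivatives of order at most k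
   exist everywhere and are continuous. *)
Fixpoint Ck (R : realType) (n k : nat) (omega : 'rV[R]_n -> R) : Prop :=
  if k is k'.+1 then
    continuous omega /\
    forall i : 'I_n,
      (forall x, derivable omega x (delta_mx 0 i)) /\
      Ck k' ('D_(delta_mx 0 i) omega)
  else continuous omega.

Definition smooth (R : realType) (n : nat) (omega : 'rV[R]_n -> R) : Prop :=
  forall k : nat, Ck k omega.

Section DifferentialStructures.
Context {R : realType} {T : choiceType}.
Implicit Types (C : set (T -> R)) (A : set T).

(* tau_C, the weakest topology making every function of C continuous: the
   supremum of the initial topologies of the members of C. *)
Definition tau C : topologicalType :=
  sup_topology (fun f : C =>
    Topological.class (initial_topology (set_val f : T -> R))).

Definition sc C : set (T -> R) :=
  [set f : T -> R | exists (n : nat) (F : 'I_n -> T -> R) (omega : 'rV[R]_n -> R),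
     [/\ forall i, C (F i), smooth omega &
         f = fun x => omega (\row_(i < n) F i x)]].

(* C_A, as a set of functions whose domain is the subtype associated to A. *)
Definition localization C A : set (A -> R) :=
  [set f : A -> R | forall p : A, exists (U : set T) (g : T -> R),
     [/\ @open (tau C) U, U (set_val p), C g &
         forall q : A, U (set_val q) -> f q = g (set_val q)]].

Arguments localization C A : clear implicits.

(* C_M for M the whole space; a function on T is identified with the
   corresponding function on the subtype of [set: T]. *)
Definition localization_full C : set (T -> R) :=
  [set f : T -> R | localization C setT (fun p => f (set_val p))].

Definition Gen (C0 : set (T -> R)) : set (T -> R) := localization_full (sc C0).

End DifferentialStructures.

Arguments localization {R T} C A.

Section Spectrum.
Context {R : realType} {T : Type}.
Implicit Type C : set (T -> R).

(* Unit-preserving homomorphisms of R-algebras C -> R. The operations of C are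
   the pointwise ones; each law is stated relationally, so that closure of C
   under the operations (automatic for a differential structure) need not be
   packaged. *)
Definition Spec C : set (C -> R) :=
  [set chi : C -> R |
    [/\ forall e : C, set_val e = (fun _ => 1) -> chi e = 1,
        forall f g h : C, set_val h = (fun x => set_val f x + set_val g x) ->
          chi h = chi f + chi g,
        forall f g h : C, set_val h = (fun x => set_val f x * set_val g x) ->
          chi h = chi f * chi g &
        forall (a : R) (f h : C), set_val h = (fun x => a * set_val f x) ->
          chi h = a * chi f]].

Definition ev C (p : T) : C -> R := fun f => set_val f p.

Definition smoothly_real_compact C : Prop :=
  forall chi : C -> R, Spec chi -> exists p : T, chi = ev p.

End Spectrum.

(* epsilon_N on R^N = (nat -> R), generated by the coordinate projections. *)
Definition epsN (R : realType) : set ((nat -> R) -> R) :=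
  Gen [set f | exists i : nat, f = fun x : nat -> R => x i].

Arguments epsN R : clear implicits.

(* Main.v *)
Require Import Defs.
From mathcomp Require Import all_boot all_order all_algebra.
From mathcomp Require Import all_classical all_reals all_analysis.
From mathcomp Require Import ring lra.

(** Let chi be a character of the structure that M inherits from R^N, and let
a_i be its value on the i-th coordinate; the only point at which chi can be
evaluation is a = (a_i). Write s_n(x) for the sum of (x_i - a_i)^2 over i < n;
chi kills s_n on M.

Everything rests on one principle ([sends_near]): no f in the structure can
stay at distance at least d > 0 from the number c = chi(f) on a neighbourhood
of a in M. Such a neighbourhood contains a cylinder around a that constrains
finitely many coordinates only, say the first n, so h = (f - c)^2 + s_n is
bounded below by a positive constant on all of M: inside the cylinder by its
first term, outside by the second. Then 1/h lies in the structure, since it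
is the composite of h with a smooth function on the line that equals 1/t for
t >= delta ([regrec]). But chi(h) = 0, which contradicts
chi(h) chi(1/h) = chi(1) = 1.

The point a belongs to M ([sends_center]): if not, there is a member g of the
structure that tends to infinity at a ([blowup]), and it violates the
principle. This g is a sum of bump functions, the n-th one depending only on
the first n coordinates and supported in s_n <= 1/(n+1). The sum is locally
finite away from a, hence locally a smooth function of finitely many
coordinates, which is all that membership asks for on M. No smooth function
of finitely many coordinates could do this on its own, so the gluing property
of differential structures is what makes the theorem work.

Finally chi is evaluation at a ([sends_ev]): a member f is continuous at a, so
if f(a) differed from chi(f) then f would stay away from chi(f) near a.

Bump functions and [regrec] come from the functions t^-n exp(-1/t), t > 0,
extended by 0; this family is closed under differentiation up to linear
combinations, which yields smoothness without polynomials. *)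

Set Implicit Arguments.
Unset Strict Implicit.
Unset Printing Implicit Defensive.

Import Order.TTheory GRing.Theory Num.Theory.
Import numFieldNormedType.Exports.

Local Open Scope classical_set_scope.
Local Open Scope ring_scope.

(** * Calculus of C^k functions of several variables *)

Section Ck_calculus.
Context {R : realType} {n : nat}.
Implicit Types f g : 'rV[R]_n -> R.

Lemma CkW k f : Ck k.+1 f -> Ck k f.
Proof.
elim: k f => [|k IH] f [fc df] //.
by split=> // i; have [? ?] := df i; split=> //; exact: IH.
Qed.

Lemma Ck_cst k (c : R) : Ck k (fun _ : 'rV[R]_n => c).
Proof.
elim: k c => [|k IH] c; first exact: cst_continuous.
split=> [|i]; first exact: cst_continuous.
split=> [x|]; first exact: (@derivable_cst _ _ _ c).
by have -> : 'D_(delta_mx 0 i) (fun _ : 'rV[R]_n => c) = (fun=> 0);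
  [apply/funext => x; exact: derive_cst | exact: IH].
Qed.

Lemma CkD k f g : Ck k f -> Ck k g -> Ck k (fun x => f x + g x).
Proof.
elim: k f g => [|k IH] f g.
  by move=> fc gc x; apply: (@continuousD _ _ _ f g); [exact: fc|exact: gc].
move=> [fc df] [gc dg]; split.
  by move=> x; apply: (@continuousD _ _ _ f g); [exact: fc|exact: gc].
move=> i; have [dfi Dfi] := df i; have [dgi Dgi] := dg i.
split; first by move=> x; exact: derivableD.
rewrite (_ : 'D_ _ _ = fun x => 'D_(delta_mx 0 i) f x + 'D_(delta_mx 0 i) g x).
  exact: IH.
by apply/funext => x; exact: deriveD.
Qed.

Lemma CkM k f g : Ck k f -> Ck k g -> Ck k (fun x => f x * g x).
Proof.
elim: k f g => [|k IH] f g.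
  by move=> fc gc x; apply: (@continuousM _ _ f g); [exact: fc|exact: gc].
move=> Cf Cg; have [fc df] := Cf; have [gc dg] := Cg; split.
  by move=> x; apply: (@continuousM _ _ f g); [exact: fc|exact: gc].
move=> i; have [dfi Dfi] := df i; have [dgi Dgi] := dg i.
split; first by move=> x; exact: derivableM.
rewrite (_ : 'D_ _ _ = fun x => f x * 'D_(delta_mx 0 i) g x +
    g x * 'D_(delta_mx 0 i) f x).
  by apply: CkD; apply: IH => //; exact: CkW.
by apply/funext => x; exact: deriveM.
Qed.

Lemma CkV k f : (forall x, f x != 0) -> Ck k f -> Ck k (fun x => (f x)^-1).
Proof.
move=> f0; elim: k => [|k IH].
  by move=> fc x; apply: continuousV; [exact: f0|exact: fc].
move=> Cf; have [fc df] := Cf; split.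
  by move=> x; apply: continuousV; [exact: f0|exact: fc].
move=> i; have [dfi Dfi] := df i.
split; first by move=> x; exact: derivableV.
rewrite (_ : 'D_ _ _ = fun x => - 1 * ((f x)^-1 * (f x)^-1) *
    'D_(delta_mx 0 i) f x).
  have fV := IH (CkW Cf).
  by do !apply: CkM => //; exact: Ck_cst.
apply/funext => x; rewrite deriveV // /GRing.scale /= mulN1r.
by rewrite expr2 invfM.
Qed.

Lemma Ck_coord k (j : 'I_n) : Ck k (fun x : 'rV[R]_n => x 0 j).
Proof.
have dc (i : 'I_n) (x : 'rV[R]_n) :
    is_derive x (delta_mx 0 i) (fun x : 'rV[R]_n => x 0 j) (i == j)%:R.
  have H : (fun h : R => h^-1 *: (((fun x : 'rV[R]_n => x 0 j) \o shift x)
     (h *: delta_mx 0 i) - x 0 j)) @ 0^' --> ((i == j)%:R : R).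
    apply: cvg_near_cst; apply/nbhs_ballP.
    exists 1 => //= h _ h0; rewrite !mxE eqxx /= addrK eq_sym.
    by rewrite /GRing.scale /= mulKf.
  by split; [apply/cvg_ex; eexists; exact: H | exact: cvg_lim H].
case: k => [|k]; first exact: coord_continuous.
split=> [|i]; first exact: coord_continuous.
split=> [x|]; first exact: (@ex_derive _ _ _ _ _ _ _ (dc i x)).
rewrite (_ : 'D_ _ _ = fun=> (i == j)%:R : R); first exact: Ck_cst.
by apply/funext => x; exact: (@derive_val _ _ _ _ _ _ _ (dc i x)).
Qed.

(** Restricting f to the line through x in direction v reduces this chain rule
    to the one-variable one; total differentiability of f, which C^k as a
    condition on partial derivatives does not give directly, is avoided. *)
Lemma derive_comp1 (phi : R -> R) (dphi : R) f x v :
  derivable f x v -> is_derive (f x) 1 phi dphi ->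
  is_derive x v (phi \o f) (dphi * 'D_v f x).
Proof.
move=> df dp.
pose l := fun h : R => f (h *: v + x).
have lim_line (g : 'rV[R]_n -> R) : 'D_v g x = 'D_1 (fun h : R => g (h *: v + x)) 0.
  rewrite /derive; set q1 := fun h => h^-1 *: _; set q2 := fun h => h^-1 *: _.
  suff -> : q1 = q2 by [].
  by apply/funext => h; rewrite /q1 /q2 /= addr0 scale0r add0r [_%:A]mulr1.
have dl : is_derive (0 : R) 1 l ('D_v f x).
  by constructor; [exact: (derivable1P f x v).1 | rewrite -lim_line].
have dp0 : is_derive (l 0) 1 phi dphi by rewrite /l scale0r add0r.
have := @is_derive1_comp R phi l 0 _ _ dp0 dl.
move=> [dpl Dpl]; constructor; first exact: (derivable1P (phi \o f) x v).2.
by rewrite lim_line -Dpl.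
Qed.

End Ck_calculus.

Section reindex.
Context {R : realType} {m n : nat} (L : {linear 'rV[R]_m -> 'rV[R]_n}).
Hypothesis Lc : continuous L.
Hypothesis Ldelta : forall i,
  L (delta_mx 0 i) = 0 \/ exists j, L (delta_mx 0 i) = delta_mx 0 j.

(** A linear map that sends basis vectors to basis vectors or to 0 turns the
    difference quotients of f o L into difference quotients of f along a
    coordinate axis, so the partial derivatives of f o L are those of f,
    composed with L, or 0. *)
Lemma Ck_precomp k (f : 'rV[R]_n -> R) : Ck k f -> Ck k (f \o L).
Proof.
have quot (g : 'rV[R]_n -> R) v x :
   (fun h : R => h^-1 *: ((g \o L \o shift x) (h *: v) - (g \o L) x)) =
   (fun h : R => h^-1 *: ((g \o shift (L x)) (h *: L v) - g (L x))).
  by apply/funext => h; rewrite /= linearP.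
elim: k f => [|k IH] f.
  by move=> fc x; apply: continuous_comp; [exact: Lc|exact: fc].
move=> [fc df]; split.
  by move=> x; apply: continuous_comp; [exact: Lc|exact: fc].
move=> i; have [Li|[j Li]] := Ldelta i.
  split; first by move=> x; rewrite /derivable quot Li; exact: derivable0.
  rewrite (_ : 'D_ _ _ = fun=> 0); first exact: Ck_cst.
  by apply/funext => x; rewrite /derive quot Li; exact: derive0.
have [dfj Dfj] := df j.
split; first by move=> x; rewrite /derivable quot Li; exact: dfj.
rewrite (_ : 'D_ _ _ = 'D_(delta_mx 0 j) f \o L); first exact: IH.
by apply/funext => x; rewrite /derive quot Li.
Qed.
End reindex.

(** * Flat functions and a regularised reciprocal *)

Section flat.
Context {R : realType}.

(** The power of 1/t in front of exp(-1/t) is a parameter so that the family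
    contains its own derivatives, up to linear combinations. *)
Definition flat (n : nat) (t : R) : R :=
  if 0 < t then t^-1 ^+ n * expR (- t^-1) else 0.

Lemma flat_le0 n t : t <= 0 -> flat n t = 0.
Proof. by rewrite leNgt /flat => /negbTE ->. Qed.

Lemma flat_ge0 n t : 0 <= flat n t.
Proof.
rewrite /flat; case: ifP => // t0.
by rewrite mulr_ge0 ?expR_ge0 // exprn_ge0 // invr_ge0 ltW.
Qed.

(** From exp(u) >= u^(n+1)/(n+1)! at u = 1/t. A linear bound is enough to
    differentiate at 0, because flat n t / t is flat n.+1 t for t > 0. *)
Lemma flat_le n t : flat n t <= n.+1`!%:R * `|t|.
Proof.
rewrite /flat; case: ifP => t0; last by rewrite mulr_ge0.
rewrite gtr0_norm // expRN.
have u0 : 0 < t^-1 by rewrite invr_gt0.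
have H := expR_ge1Dxn n (ltW u0).
have F0 : (0 : R) < n.+1`!%:R by rewrite ltr0n fact_gt0.
rewrite ler_pdivrMr ?expR_gt0 //.
have {}H : t^-1 ^+ n.+1 / n.+1`!%:R <= expR t^-1.
  by apply: le_trans H; rewrite lerDr.
apply: le_trans (ler_wpM2l _ H); last by rewrite mulr_ge0 ?ltW.
rewrite le_eqVlt; apply/orP; left; apply/eqP.
rewrite exprSr; field.
by rewrite !gt_eqF.
Qed.

Lemma is_derive_flat n (t : R) :
  is_derive t (1 : R) (flat n) (- n%:R * flat n.+1 t + flat n.+2 t : R).
Proof.
have [t0|t0|<-] := ltgtP 0 t.
- pose V := fun u : R => u^-1.
  have E : \near t, (V ^+ n * (expR \o - V)) t = flat n t.
    near=> u; rewrite /flat ifT; first by rewrite mulrfctE exprfctE.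
    by near: u; exact: lt_nbhsr.
  apply: near_eq_is_derive E _.
  have dV : is_derive t (1 : R) V (- t ^- 2 *: (1 : R)).
    by apply: (@is_deriveV R id); rewrite gt_eqF.
  have dX := @is_deriveX _ _ V n t 1 _ dV.
  have dN := is_deriveN dV.
  have dE := @is_derive1_comp R expR (- V) t _ _ (is_derive_expR _) dN.
  apply: (is_derive_eq (is_deriveM dX dE)).
  rewrite /flat !t0 /V /GRing.scale /= !fctE /=.
  (* The exponent of a derivative of a power is a predecessor, so n = 0 is
     treated apart. *)
  case: n {dX} => [|n] /=.
    by rewrite expr0 expr1 expr2 exprVn; ring.
  rewrite -exprVn !exprS; ring.
- have E : \near t, (cst 0 : R -> R) t = flat n t.
    near=> u.
    rewrite /flat ifN // -leNgt ltW //; near: u; exact: lt_nbhsl.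
  apply: near_eq_is_derive E _.
  rewrite !(flat_le0 _ (ltW t0)) mulr0 addr0; exact: is_derive_cst.
- have z k : flat k 0 = 0 by rewrite /flat ltxx.
  rewrite !z mulr0 addr0.
  have H : (fun h : R => h^-1 *: ((flat n \o shift 0) (h *: (1 : R)) - flat n 0))
      @ 0^' --> (0 : R).
    apply/cvgrPdist_le => e e0.
    have K0 : (0 : R) < n.+2`!%:R by rewrite ltr0n fact_gt0.
    exists (e / n.+2`!%:R); first by rewrite /= divr_gt0.
    move=> h /=; rewrite sub0r normrN => he h0.
    rewrite sub0r normrN addr0 z subr0 /GRing.scale /= mulr1.
    have -> : h^-1 * flat n h = flat n.+1 h.
      by rewrite /flat; case: ifP => _; rewrite ?mulr0 // exprS mulrA.
    rewrite ger0_norm ?flat_ge0 //; apply: le_trans (flat_le _ _) _.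
    by rewrite -ler_pdivlMl // mulrC ltW.
  by constructor; [apply/cvg_ex; eexists; exact: H | exact: cvg_lim H].
Unshelve. all: by end_near. Qed.

Lemma Ck_flat m k n (f : 'rV[R]_m -> R) :
  smooth f -> Ck k (fun x => flat n (f x)).
Proof.
move=> fs.
have cont j : continuous (fun x => flat j (f x)).
  move=> x; apply: (@continuous_comp _ _ _ f (flat j)); first exact: (fs 0%N).
  apply: differentiable_continuous; apply/derivable1_diffP.
  exact: (@ex_derive _ _ _ _ _ _ _ (is_derive_flat j (f x))).
elim: k n => [|k IH] n //=.
split=> // i; have [dfi Dfi] := (fs k.+1).2 i.
have D x := derive_comp1 (dfi x) (is_derive_flat n (f x)).
split=> [x|]; first exact: (@ex_derive _ _ _ _ _ _ _ (D x)).
rewrite (_ : 'D_ _ _ = fun x =>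
    (- n%:R * flat n.+1 (f x) + flat n.+2 (f x)) * 'D_(delta_mx 0 i) f x).
  by do ![apply: CkM|apply: CkD|exact: Ck_cst|exact: IH].
by apply/funext => x; exact: (@derive_val _ _ _ _ _ _ _ (D x)).
Qed.

Lemma flat_gt0 n t : 0 < t -> 0 < flat n t.
Proof.
by move=> t0; rewrite /flat t0 mulr_gt0 ?expR_gt0 // exprn_gt0 // invr_gt0.
Qed.

Lemma flat0_homo s t : s <= t -> flat 0 s <= flat 0 t.
Proof.
move=> st; have [s0|s0] := ltP 0 s; last by rewrite (flat_le0 _ s0) flat_ge0.
rewrite /flat s0 (lt_le_trans s0 st) !expr0 !mul1r ler_expR lerN2.
by rewrite lef_pV2 ?posrE // (lt_le_trans s0 st).
Qed.

(** A smooth function on the whole line that agrees with 1/t for t >= d. The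
    correction added to t vanishes for t >= d; for t <= 0 it is at least
    1 + t^2 > -t, and it is nonnegative in between, so the denominator is
    positive everywhere. *)
Definition regrec (d t : R) : R :=
  (t + (1 + t * t) * (flat 0 (d - t) / flat 0 d))^-1.

Lemma regrec_den_gt0 d t : 0 < d ->
  0 < t + (1 + t * t) * (flat 0 (d - t) / flat 0 d).
Proof.
move=> d0; have q0 := flat_gt0 0 d0.
have [t0|t0] := ltP 0 t.
  rewrite ltr_wpDr // mulr_ge0 //; first by rewrite addr_ge0 // mulr_ge0 // ltW.
  by rewrite divr_ge0 // flat_ge0.
have : 1 <= flat 0 (d - t) / flat 0 d.
  by rewrite ler_pdivlMr // mul1r flat0_homo // lerDl oppr_ge0.
move: (flat 0 (d - t) / _) => q q1.
have s1 : 1 + t * t <= (1 + t * t) * q by rewrite ler_peMr // addr_ge0 // sqr_ge0.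
have := sqr_ge0 (t + 2^-1).
nra.
Qed.

Lemma regrecE d t : 0 < d -> d <= t -> t * regrec d t = 1.
Proof.
move=> d0 dt; rewrite /regrec flat_le0 ?subr_le0 // mul0r mulr0 addr0 mulfV //.
by rewrite gt_eqF // (lt_le_trans d0).
Qed.

Lemma smooth_regrec n d (f : 'rV[R]_n -> R) : 0 < d ->
  smooth f -> smooth (fun x => regrec d (f x)).
Proof.
move=> d0 fs k; apply: CkV => [x|]; first by rewrite gt_eqF // regrec_den_gt0.
have F : Ck k (fun x => flat 0 (d - f x)).
  apply: Ck_flat => j; apply: CkD; first exact: Ck_cst.
  rewrite (_ : (fun x => - f x) = fun x => (-1) * f x).
    by apply: CkM => //; exact: Ck_cst.
  by apply/funext => x; rewrite mulN1r.
by do ![apply: CkD|apply: CkM|exact: Ck_cst|exact: fs|exact: F].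
Qed.

End flat.

(** * Smooth composition over a set of functions *)


Section block_projections.
Context {R : realType} {m n : nat}.

Lemma smooth_lsubmx (f : 'rV[R]_m -> R) :
  smooth f -> smooth (fun x : 'rV[R]_(m + n) => f (lsubmx x)).
Proof.
move=> fs k; apply: (@Ck_precomp _ _ _ lsubmx) => [x A [P xP PA]|i|].
- exists (fun a b => match fintype.split b with inl b => P a b | inr _ => setT end).
    move=> a b; case: fintype.split_ordP => j bE; last exact: filterT.
    by rewrite bE; have := xP a j; rewrite mxE.
  move=> y yP; apply: PA => a b; have := yP a (lshift n b).
  by rewrite (unsplitK (inl b)) mxE.
- rewrite -[i]splitK; case: (fintype.split i) => j /=.
    by right; exists j; apply/rowP => l; rewrite !mxE eq_lshift.
  by left; apply/rowP => l; rewrite !mxE eq_lrshift.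
- exact: fs.
Qed.

Lemma smooth_rsubmx (f : 'rV[R]_n -> R) :
  smooth f -> smooth (fun x : 'rV[R]_(m + n) => f (rsubmx x)).
Proof.
move=> fs k; apply: (@Ck_precomp _ _ _ rsubmx) => [x A [P xP PA]|i|].
- exists (fun a b => match fintype.split b with inl _ => setT | inr b => P a b end).
    move=> a b; case: fintype.split_ordP => j bE; first exact: filterT.
    by rewrite bE; have := xP a j; rewrite mxE.
  move=> y yP; apply: PA => a b; have := yP a (rshift m b).
  by rewrite (unsplitK (inr b)) mxE.
- rewrite -[i]splitK; case: (fintype.split i) => j /=.
    by left; apply/rowP => l; rewrite !mxE eq_rlshift.
  by right; exists j; apply/rowP => l; rewrite !mxE eq_rshift.
- exact: fs.
Qed.

End block_projections.

Section sc_algebra.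
Context {R : realType} {T : choiceType} (C : set (T -> R)).
Implicit Types f g : T -> R.

Lemma sc_cst (c : R) : sc C (fun=> c).
Proof.
exists 0%N, (fun _ _ => 0), (fun=> c); split => //; first by case.
by move=> k; exact: Ck_cst.
Qed.

Lemma sub_sc : C `<=` sc C.
Proof.
move=> f Cf; exists 1%N, (fun=> f), (fun x => x 0 ord0); split => //.
  by move=> k; exact: Ck_coord.
by apply/funext => x; rewrite mxE.
Qed.

Lemma sc_comp (eta : R -> R) f :
  (forall n (w : 'rV[R]_n -> R), smooth w -> smooth (fun x => eta (w x))) ->
  sc C f -> sc C (fun x => eta (f x)).
Proof.
move=> es [n [F [w [CF ws ->]]]].
by exists n, F, (fun x => eta (w x)); split => //; exact: es.
Qed.

(** The two functions may depend on different members of C; concatenating the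
    two families turns both into functions of one common family. *)
Lemma sc_comp2 (op : R -> R -> R) f g :
  (forall n (v w : 'rV[R]_n -> R),
    smooth v -> smooth w -> smooth (fun x => op (v x) (w x))) ->
  sc C f -> sc C g -> sc C (fun x => op (f x) (g x)).
Proof.
move=> os [m [F [v [CF vs ->]]]] [n [G [w [CG ws ->]]]].
exists (m + n)%N, (fun i => match fintype.split i with inl i => F i | inr i => G i end),
  (fun x : 'rV_(m + n) => op (v (lsubmx x)) (w (rsubmx x))); split.
- by move=> i; case: (fintype.split i).
- by apply: os; [exact: smooth_lsubmx|exact: smooth_rsubmx].
apply/funext => x; congr (op (v _) (w _)); apply/rowP => i; rewrite !mxE.
  by rewrite (unsplitK (inl i)).
by rewrite (unsplitK (inr i)).
Qed.

Lemma scD f g : sc C f -> sc C g -> sc C (fun x => f x + g x).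
Proof. by apply: sc_comp2 => n v w vs ws k; exact: CkD. Qed.

Lemma scM f g : sc C f -> sc C g -> sc C (fun x => f x * g x).
Proof. by apply: sc_comp2 => n v w vs ws k; exact: CkM. Qed.

Lemma sc_sum (n : nat) (F : nat -> T -> R) :
  (forall i, sc C (F i)) -> sc C (fun x => \sum_(i < n) F i x).
Proof.
move=> CF; elim: n => [|n IH].
  rewrite (_ : (fun _ => _) = fun=> 0); first exact: sc_cst.
  by apply/funext => x; rewrite big_ord0.
rewrite (_ : (fun _ => _) = fun x => \sum_(i < n) F i x + F n x).
  exact: scD.
by apply/funext => x; rewrite big_ord_recr.
Qed.

End sc_algebra.

(** * The structure of R^N and its topology *)

Section cylinders.
Context {R : realType}.
Notation RN := (nat -> R).
Implicit Types (a x : RN) (n : nat) (e : R).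

Definition coords : set (RN -> R) :=
  [set f | exists i : nat, f = fun x : RN => x i].

Definition cyl a n e : set RN := [set x | forall i, (i < n)%N -> `|x i - a i| < e].

(** The neighbourhood filter of a for the product topology, given by cylinders
    around a. It is used in place of the topologies attached to the various
    sets of functions: [tau_open_cyl] and [cyl_tau_open] compare them with
    it. *)
Definition cylF a : set_system RN :=
  filter_from [set ne : nat * R | 0 < ne.2] (fun ne => cyl a ne.1 ne.2).

Lemma cyl_center a n e : 0 < e -> cyl a n e a.
Proof. by move=> e0 i _; rewrite subrr normr0. Qed.

Lemma cyl_subset a m n e d : (n <= m)%N -> d <= e -> cyl a m d `<=` cyl a n e.
Proof.
by move=> nm de x ax i ni; apply: lt_le_trans (ax i _) de; exact: leq_trans nm.
Qed.

#[global] Instance cylF_filter a : Filter (cylF a).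
Proof.
apply: filter_from_filter; first by exists (0%N, 1); rewrite /= ltr01.
move=> [m d] [n e] /= d0 e0; exists (maxn m n, Num.min d e) => /=.
  by rewrite lt_min d0 e0.
move=> x ax; split; apply: cyl_subset ax.
- exact: leq_maxl.
- by rewrite ge_min lexx.
- exact: leq_maxr.
- by rewrite ge_min lexx orbT.
Qed.

Lemma coord_cvg a i : x i @[x --> cylF a] --> a i.
Proof.
move=> A /nbhs_ballP [e /= e0 eA]; exists (i.+1, e) => //= x ax.
by apply: eA; rewrite /ball /= distrC; exact: ax.
Qed.

Lemma sc_coords_cvg f a : sc coords f -> f x @[x --> cylF a] --> f a.
Proof.
move=> [n [F [w [CF ws ->]]]].
apply: (@cvg_comp _ _ _ (fun x => \row_i F i x) w); last exact: (ws 0%N).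
move=> A [P aP PA].
suff : cylF a [set x | forall i, P 0 i (F i x)].
  apply: filterS => x xP; apply: PA => i j.
  by rewrite mxE ord1; exact: xP.
apply: (@filter_forall _ _ (fun i => [set x | P 0 i (F i x)]) _ (cylF_filter a)) => i.
have [j Fij] := CF i.
have := aP 0 i; rewrite mxE Fij; exact: coord_cvg.
Qed.

(** The topology generated by C is the weakest one making C continuous, hence
    it is coarser than the product topology as soon as the members of C are
    continuous for the latter. *)
Lemma tau_open_cyl (C : set (RN -> R)) (U : set RN) a :
  (forall f, C f -> f x @[x --> cylF a] --> f a) ->
  @open (tau C) U -> U a -> cylF a U.
Proof.
move=> Cc oU Ua.
have H : cylF a --> (a : tau C).
  apply/cvg_sup => f A; rewrite nbhsE /= => -[B [[D oD <-] Da] DA].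
  rewrite nbhs_filterE; apply: filterS DA _.
  apply: (Cc _ (set_valP f)); exact: open_nbhs_nbhs.
by apply: H; exact: open_nbhs_nbhs.
Qed.

Lemma cyl_tau_open (C : set (RN -> R)) a n e : 0 < e -> coords `<=` C ->
  exists U, [/\ @open (tau C) U, U a & U `<=` cyl a n e].
Proof.
move=> e0 cC.
have pc i : (fun x : tau C => (x : RN) i) x @[x --> (a : tau C)] --> a i.
  pose p := fun x : RN => x i.
  have Cp : C p by apply: cC; exists i.
  pose f : C := SigSub (mem_set Cp).
  have /cvg_sup /(_ f) H : nbhs (a : tau C) --> (a : tau C) by [].
  have : {for a, continuous (p : initial_topology p -> R)}.
    exact: initial_continuous.
  by apply: cvg_trans; apply: cvg_app H.
have : nbhs (a : tau C) (cyl a n e).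
  rewrite (_ : cyl a n e = [set x | forall i : 'I_n, `|x i - a i| < e]).
    apply: (@filter_forall _ _ (fun i : 'I_n => [set x : RN | `|x i - a i| < e]) _
      (@nbhs_filter (tau C) a)) => i.
    move/cvgrPdist_lt: (pc i) => /(_ _ e0).
    by apply: filterS => x; rewrite distrC.
  by apply/seteqP; split=> x ax i; [exact: ax | move=> ni; exact: (ax (Ordinal ni))].
rewrite nbhsE => -[U [oU Ua] Ucyl].
by exists U.
Qed.

Lemma sub_epsN : sc coords `<=` epsN R.
Proof.
move=> f sf p; exists setT, f; split => //; exact: openT.
Qed.

Lemma epsN_local f a : epsN R f ->
  exists2 g, sc coords g & cylF a [set x | f x = g x].
Proof.
move=> /(_ (SigSub (mem_set (I : [set: RN] a)))) [U [g [oU Ua sg fg]]].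
exists g => //; apply: filterS (tau_open_cyl _ oU Ua).
  by move=> x Ux; have := fg (SigSub (mem_set (I : [set: RN] x))); exact.
by move=> h; exact: sc_coords_cvg.
Qed.

Lemma epsN_cvg f a : epsN R f -> f x @[x --> cylF a] --> f a.
Proof.
move=> /(epsN_local a) [g sg fg].
have -> : f a = g a.
  by case: fg => -[n e] /= e0; apply; exact: cyl_center.
apply: (cvg_trans _ (sc_coords_cvg sg)); apply: near_eq_cvg.
by apply: filterS fg => x /= ->.
Qed.

(** The two nested localizations, from smooth composites of coordinates to the
    structure of R^N and from there to M, collapse into a single one over
    cylinders. All later membership proofs go through this description. *)
Lemma localizationP (M : set RN) (f : M -> R) :
  localization (epsN R) M f <->
  forall p : M, exists2 g, sc coords g &
    cylF (set_val p) [set x | forall q : M, set_val q = x -> f q = g x].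
Proof.
split=> [Lf p|Lf p].
  have [U [g [oU Up eg fg]]] := Lf p.
  have [h sh gh] := epsN_local (set_val p) eg.
  exists h => //.
  have UF : cylF (set_val p) U.
    by apply: tau_open_cyl oU Up => k; exact: epsN_cvg.
  apply: filterS2 UF gh => x Ux ghx q qx.
  by rewrite -ghx -qx; apply: fg; rewrite qx.
have [g sg [[n e] /= e0 fg]] := Lf p.
have [|U [oU Up Ucyl]] := @cyl_tau_open (epsN R) (set_val p) n e e0.
  by apply: subset_trans sub_epsN; exact: sub_sc.
exists U, g; split => //; first exact: sub_epsN.
by move=> q Uq; exact: fg (Ucyl _ Uq) _ erefl.
Qed.

End cylinders.


(** * Operations on the structure of a subset *)

Section localization_algebra.
Context {R : realType} (M : set (nat -> R)).
Notation C := (localization (epsN R) M).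
Implicit Types f g : M -> R.

Lemma localization_sc (h : (nat -> R) -> R) :
  sc coords h -> C (fun q => h (set_val q)).
Proof.
by move=> sh; apply/localizationP => p; exists h => //; apply: filterE => x q ->.
Qed.

Lemma localization_coord i : C (fun q => (set_val q : nat -> R) i).
Proof.
apply: (@localization_sc (fun x => x i)).
by apply: sub_sc; exists i.
Qed.

Lemma localization_cst c : C (fun=> c).
Proof. by apply: (@localization_sc (fun=> c)); exact: sc_cst. Qed.

Lemma localization_comp (eta : R -> R) f :
  (forall n (w : 'rV[R]_n -> R), smooth w -> smooth (fun x => eta (w x))) ->
  C f -> C (fun x => eta (f x)).
Proof.
move=> es /localizationP Cf; apply/localizationP => p; have [h sh fh] := Cf p.
exists (fun x => eta (h x)); first exact: sc_comp.
by apply: filterS fh => x fx q qx; rewrite (fx q qx).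
Qed.

Lemma localization_comp2 (op : R -> R -> R) f g :
  (forall n (v w : 'rV[R]_n -> R),
    smooth v -> smooth w -> smooth (fun x => op (v x) (w x))) ->
  C f -> C g -> C (fun x => op (f x) (g x)).
Proof.
move=> os /localizationP Cf /localizationP Cg; apply/localizationP => p.
have [[h sh fh] [k sk gk]] := (Cf p, Cg p).
exists (fun x => op (h x) (k x)); first exact: sc_comp2.
by apply: filterS2 fh gk => x fx gx q qx; rewrite (fx q qx) (gx q qx).
Qed.

Lemma localizationD f g : C f -> C g -> C (fun x => f x + g x).
Proof. by apply: localization_comp2 => n v w vs ws k; exact: CkD. Qed.

Lemma localizationM f g : C f -> C g -> C (fun x => f x * g x).
Proof. by apply: localization_comp2 => n v w vs ws k; exact: CkM. Qed.

Lemma localization_cvg f (p : M) (e : R) : C f -> 0 < e ->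
  cylF (set_val p) [set x | forall q : M, set_val q = x -> `|f p - f q| < e].
Proof.
move=> /localizationP Cf e0; have [h sh fh] := Cf p.
have fp : f p = h (set_val p).
  by case: fh => -[n d] /= d0 fh; exact: (fh _ (cyl_center _ d0) p erefl).
have /cvgrPdist_lt /(_ _ e0) hc := sc_coords_cvg sh (a := set_val p).
by apply: filterS2 fh hc => x fx hx q qx; rewrite fp (fx q qx).
Qed.

End localization_algebra.

(** * A function blowing up at a point outside M *)

Section sqdist.
Context {R : realType} (a : nat -> R).

Definition sqdist n (x : nat -> R) : R := \sum_(i < n) (x i - a i) ^+ 2.

Lemma sqdist_homo m n x : (m <= n)%N -> sqdist m x <= sqdist n x.
Proof.
move=> /subnKC <-; elim: (n - m)%N => [|k IH]; first by rewrite addn0.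
by rewrite addnS /sqdist big_ord_recr /= ler_wpDr // sqr_ge0.
Qed.

Lemma sqdist_out n e x : 0 < e -> ~ cyl a n e x -> e ^+ 2 <= sqdist n x.
Proof.
move=> e0 /existsNP [i /not_implyP [ni /negP]]; rewrite -leNgt => ei.
apply: (@le_trans _ _ ((x i - a i) ^+ 2)).
  by rewrite -(real_normK (num_real (x i - a i))) lerXn2r // nnegrE ltW.
apply: le_trans (sqdist_homo x ni); rewrite /sqdist big_ord_recr /= lerDr.
by rewrite sumr_ge0 // => j _; exact: sqr_ge0.
Qed.

Lemma sc_sqdist n : sc coords (sqdist n).
Proof.
apply: (@sc_sum _ _ _ n (fun i x => (x i - a i) ^+ 2)) => i.
have s : sc coords (fun x : nat -> R => x i + (- a i)).
  by apply: scD; [apply: sub_sc; exists i | exact: sc_cst].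
exact: scM.
Qed.

Lemma sqdist_center n : sqdist n a = 0.
Proof. by rewrite /sqdist big1 // => i _; rewrite subrr expr0n. Qed.

(** Normalised so that it is at least 1 where the squared distance is below
    half of the radius 1/(n+1). *)
Definition bump n x : R :=
  flat 0 (n.+1%:R^-1 - sqdist n x) / flat 0 (n.+1%:R^-1 / 2).

Lemma rad_gt0 n : 0 < n.+1%:R^-1 :> R.
Proof. by rewrite invr_gt0 ltr0n. Qed.

Lemma rad_homo m n : (m <= n)%N -> n.+1%:R^-1 <= m.+1%:R^-1 :> R.
Proof. by move=> mn; rewrite lef_pV2 ?posrE ?ltr0n // ler_nat. Qed.

Lemma bump_ge0 n x : 0 <= bump n x.
Proof. by rewrite /bump divr_ge0 // flat_ge0. Qed.

Lemma bump_ge1 m n x : (m <= n)%N -> sqdist n x < n.+1%:R^-1 / 2 -> 1 <= bump m x.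
Proof.
move=> mn sx; have q0 : 0 < (m.+1%:R^-1 / 2 : R) by rewrite divr_gt0 // rad_gt0.
rewrite /bump ler_pdivlMr ?flat_gt0 // mul1r flat0_homo //.
have := sqdist_homo x mn; have := rad_homo mn; move: sx.
by move: (m.+1%:R^-1 : R) (n.+1%:R^-1 : R) => r t; lra.
Qed.

Lemma bump_eq0 m n x : (m <= n)%N -> m.+1%:R^-1 <= sqdist m x -> bump n x = 0.
Proof.
move=> mn sx; rewrite /bump flat_le0 ?mul0r // subr_le0.
exact: le_trans (rad_homo mn) (le_trans sx (sqdist_homo x mn)).
Qed.

Lemma sc_bump n : sc coords (bump n).
Proof.
apply: scM; last exact: sc_cst.
apply: (@sc_comp _ _ _ (fun t => flat 0 (n.+1%:R^-1 - t))) (sc_sqdist n).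
move=> m w ws k; apply: Ck_flat => j; apply: CkD; first exact: Ck_cst.
rewrite (_ : (fun x => - w x) = fun x => (-1) * w x).
  by apply: CkM; [exact: Ck_cst | exact: ws].
by apply/funext => x; rewrite mulN1r.
Qed.

Definition bumps m x : R := \sum_(n < m) bump n x.

Lemma bumps_homo m n x : (m <= n)%N -> bumps m x <= bumps n x.
Proof.
move=> /subnKC <-; elim: (n - m)%N => [|k IH]; first by rewrite addn0.
by rewrite addnS /bumps big_ord_recr /= ler_wpDr // bump_ge0.
Qed.

(** Once the n-th bump vanishes at x because the squared distance to a exceeds
    the radius, all later ones do: the squared distances increase with n while
    the radii decrease. So the partial sums are stationary, and the
    infinite sum of bumps can be read off from any such partial sum. *)
Lemma bumps_stable m n x : m.+1%:R^-1 <= sqdist m x ->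
  n.+1%:R^-1 <= sqdist n x -> bumps m x = bumps n x.
Proof.
wlog mn : m n / (m <= n)%N.
  move=> H sm sn.
  by have [/H|/ltnW /H] := leqP m n; [apply|move=> E; exact/esym/E].
move=> sm _; rewrite -(subnKC mn); elim: (n - m)%N => [|k IH]; first by rewrite addn0.
by rewrite addnS /bumps big_ord_recr /= (bump_eq0 (leq_addr _ _) sm) addr0.
Qed.

Lemma sqdist_apart x : x != a -> exists m, m.+1%:R^-1 < sqdist m x.
Proof.
move=> /eqP xa; have [i xi] : exists i, x i != a i.
  apply: contrapT => /forallNP H; apply: xa; apply/funext => i.
  by have /negP := H i; rewrite negbK => /eqP.
have d0 : 0 < (x i - a i) ^+ 2 by rewrite exprn_even_gt0 //= subr_eq0.
have [k] := ltr_add_invr d0; rewrite add0r => kd.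
(* The index must involve the coordinate i and have its radius below the
   square of x i - a i. *)
exists (maxn i.+1 k); apply: le_lt_trans (rad_homo (leq_maxr _ _)) _.
apply: lt_le_trans kd _; apply: le_trans (sqdist_homo x (leq_maxl i.+1 k)).
by rewrite /sqdist big_ord_recr /= lerDr sumr_ge0 // => j _; exact: sqr_ge0.
Qed.

(** The infinite sum of all bumps. It is evaluated at q through a partial sum
    beyond which the bumps vanish at q; near a given p of M one length serves
    all points, by continuity of the squared distances. *)
Lemma blowup (M : set (nat -> R)) : ~ M a ->
  exists2 g : M -> R, localization (epsN R) M g &
    forall b : R, cylF a [set x | forall q : M, set_val q = x -> b <= g q].
Proof.
move=> Ma.
have apart (q : M) : exists m, m.+1%:R^-1 < sqdist m (set_val q).
  apply: sqdist_apart; apply/eqP => qa; apply: Ma; rewrite -qa; exact: set_valP.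
have [N HN] := choice apart.
exists (fun q => bumps (N q) (set_val q)).
  apply/localizationP => p; exists (bumps (N p)).
    by apply: (@sc_sum _ _ _ (N p) bump) => i; exact: sc_bump.
  have near_p : cylF (set_val p) [set x | (N p).+1%:R^-1 < sqdist (N p) x].
    exact: (sc_coords_cvg (sc_sqdist (N p)) (lt_nbhsr (HN p))).
  apply: filterS near_p => x /= Hx q qx; rewrite -qx; apply: bumps_stable.
    exact/ltW/HN.
  by rewrite qx ltW.
move=> b; have [n bn] : exists n : nat, b <= n.+1%:R.
  exists (Num.bound `|b|); apply: le_trans (ler_norm _) _.
  by apply/ltW/(lt_le_trans (archi_boundP (normr_ge0 b))); rewrite ler_nat.
have h0 : sqdist n a < n.+1%:R^-1 / 2 by rewrite sqdist_center divr_gt0 // rad_gt0.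
have near_a : cylF a [set x | sqdist n x < n.+1%:R^-1 / 2].
  exact: (sc_coords_cvg (sc_sqdist n) (lt_nbhsl h0)).
apply: filterS near_a => x /= Hx q qx; apply: le_trans bn _; rewrite qx.
(* The n-th bump is still at work at q, so the partial sum chosen for q
   contains the bumps of index at most n, each of which is at least 1. *)
have nN : (n.+1 <= N q)%N.
  rewrite ltnNge; apply/negP => Nn.
  have := sqdist_homo x Nn; have := rad_homo Nn; have := HN q; have := rad_gt0 n.
  rewrite qx; move: Hx.
  by move: ((N q).+1%:R^-1 : R) (n.+1%:R^-1 : R) => r t; lra.
apply: le_trans (bumps_homo x nN); rewrite -[leLHS]mulr1 mulr_natl.
rewrite -[n.+1 in leLHS]card_ord -sumr_const; apply: ler_sum => i _.
by apply: bump_ge1 Hx; rewrite -ltnS.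
Qed.

End sqdist.

(** * Characters are evaluations *)

Section spectrum.
Context {R : realType} (M : set (nat -> R)).
Notation C := (localization (epsN R) M).
Variable chi : C -> R.
Hypothesis Hchi : Spec chi.

(** The value of chi as a relation on plain functions, so that sums and products
    can be formed without carrying membership proofs inside terms. *)
Definition sends (f : M -> R) (c : R) :=
  exists2 phi : C, set_val phi = f & chi phi = c.

Lemma sends_ex f : C f -> exists c, sends f c.
Proof. by move=> Cf; eexists; exists (SigSub (mem_set Cf)). Qed.

Lemma sends_mem f c : sends f c -> C f.
Proof. by case=> phi <- _; exact: set_valP. Qed.

Lemma sends_inj f c d : sends f c -> sends f d -> c = d.
Proof. by move=> [phi <- <-] [psi /val_inj -> <-]. Qed.

Lemma sends_cst c : sends (fun=> c) c.
Proof.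
have [h1 _ _ hZ] := Hchi.
have C1 : C (fun=> 1) := localization_cst 1.
have Cc : C (fun=> c) := localization_cst c.
exists (SigSub (mem_set Cc)) => //.
rewrite (hZ c (SigSub (mem_set C1))) ?(h1 (SigSub (mem_set C1))) ?mulr1 //.
by apply/funext => x /=; rewrite mulr1.
Qed.

Lemma sendsD f g c d : sends f c -> sends g d -> sends (fun x => f x + g x) (c + d).
Proof.
move=> sf sg; have [_ hD _ _] := Hchi.
have Cfg := localizationD (sends_mem sf) (sends_mem sg).
case: sf sg Cfg => phi <- <- [psi <- <-] Cfg.
by exists (SigSub (mem_set Cfg)) => //; exact: hD.
Qed.

Lemma sendsM f g c d : sends f c -> sends g d -> sends (fun x => f x * g x) (c * d).
Proof.
move=> sf sg; have [_ _ hM _] := Hchi.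
have Cfg := localizationM (sends_mem sf) (sends_mem sg).
case: sf sg Cfg => phi <- <- [psi <- <-] Cfg.
by exists (SigSub (mem_set Cfg)) => //; exact: hM.
Qed.

Lemma sends0_sqr f c : sends f c -> sends (fun x => (f x - c) ^+ 2) 0.
Proof.
move=> sf; have := sendsD sf (sends_cst (- c)); rewrite subrr => s0.
by have := sendsM s0 s0; rewrite mulr0.
Qed.

Variable a : nat -> R.
Hypothesis Ha : forall i, sends (fun q => (set_val q : nat -> R) i) (a i).

Lemma sends_sqdist n : sends (fun q => sqdist a n (set_val q)) 0.
Proof.
elim: n => [|n IH].
  rewrite (_ : (fun=> _) = fun=> 0); first exact: sends_cst.
  by apply/funext => q; rewrite /sqdist big_ord0.
have := sendsD IH (sends0_sqr (Ha n)); rewrite addr0.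
congr sends; apply/funext => q.
by rewrite /sqdist big_ord_recr.
Qed.

(** Such an f is invertible in the structure, with inverse [regrec d] composed
    with f, and a character does not vanish on a unit. *)
Lemma bounded_below_not_sent_to0 f : C f -> (exists2 d, 0 < d & forall q, d <= f q) ->
  ~ sends f 0.
Proof.
move=> Cf [d d0 df] sf.
have [k sk] : exists k, sends (fun q => regrec d (f q)) k.
  apply: sends_ex; apply: localization_comp => // n w.
  exact: smooth_regrec.
have := sendsM sf sk; rewrite mul0r (_ : (fun=> _) = fun=> 1).
  by move=> /(sends_inj (sends_cst 1)) /eqP; rewrite oner_eq0.
by apply/funext => q; exact: regrecE.
Qed.

(** Adding the squared distance makes the failure of f to approach c near a into
    a positive lower bound over all of M, for a function that chi kills. *)
Lemma sends_near f c d : sends f c -> 0 < d ->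
  ~ cylF a [set x | forall q : M, set_val q = x -> d <= `|f q - c|].
Proof.
move=> sf d0 [[n e] /= e0 H].
have := sendsD (sends0_sqr sf) (sends_sqdist n); rewrite addr0 => s0.
apply: (bounded_below_not_sent_to0 (sends_mem s0) _ s0).
exists (Num.min (d ^+ 2) (e ^+ 2)); first by rewrite lt_min !exprn_gt0.
move=> q; rewrite ge_min; have [qe|qe] := pselect (cyl a n e (set_val q)).
  apply/orP; left; rewrite -[leLHS]addr0 lerD //.
    rewrite -(real_normK (num_real (f q - c))) lerXn2r ?nnegrE ?(ltW d0) //.
    exact: H qe q erefl.
  by rewrite /sqdist sumr_ge0 // => i _; exact: sqr_ge0.
apply/orP; right; rewrite -[leLHS]add0r lerD ?sqr_ge0 //.
exact: sqdist_out.
Qed.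

(** Otherwise the function blowing up at a exceeds its own value under chi
    by 1 near a. *)
Lemma sends_center : M a.
Proof.
apply: contrapT => Ma; have [g Cg gb] := blowup Ma.
have [c gc] := sends_ex Cg; apply: (sends_near gc ltr01).
apply: filterS (gb (c + 1)) => x gx q qx.
apply: le_trans (ler_norm _); rewrite lerBrDr addrC; exact: gx.
Qed.

Lemma sends_ev f c (p : M) : set_val p = a -> sends f c -> c = f p.
Proof.
move=> pa sf; apply/eqP; rewrite eq_sym; apply: contraT => fc.
have d0 : 0 < `|f p - c| / 2 by rewrite divr_gt0 // normr_gt0 subr_eq0.
exfalso; apply: (sends_near sf d0).
have := localization_cvg p (sends_mem sf) d0; rewrite pa.
apply: filterS => x fx q qx; have := fx q qx.
have := ler_normD (f p - f q) (f q - c); rewrite addrA subrK.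
lra.
Qed.

End spectrum.

Theorem theorem1 (R : realType) (M : set (nat -> R)) (hM : M !=set0) :
  smoothly_real_compact (localization (epsN R) M).
Proof.
move=> chi Hchi.
have [a Ha] := choice (fun i => sends_ex chi (@localization_coord R M i)).
pose p : M := SigSub (mem_set (sends_center Hchi Ha)).
exists p; apply/funext => phi.
by apply: (sends_ev Hchi Ha (p := p)) => //; exists phi.
Qed.
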